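(* Consider the online maximum $k$-interval coverage problem in the Arbitrary-Length (AL) setting, with quota $k\ge 2$ (both for the case where the number of released sub-intervals is known in advance and for the case where it is not). Then no online deterministic algorithm achieves a bounded competitive ratio; that is, for every deterministic online algorithm $\mathrm{ALG}$ and every real number $\rho\ge 1$, there is an instance $\mathbb{V}$ with $\mathrm{OPT}(\mathbb{V})>\rho\,\mathrm{ALG}(\mathbb{V})$.
   Context: Online maximum $k$-interval coverage problem: there is a target interval $[0,a]$ (part of the instance). Sub-intervals $V_1,V_2,\dots$ with $V_i=[o_i,d_i]\subseteq[0,a]$ are released one at a time in an adversarial order. On the release of $V_i$ the algorithm must immediately and irrevocably accept or reject it (no preemption), without knowledge of future sub-intervals. At most $k$ sub-intervals may be accepted. For a set $U$ of sub-intervals let $Len(U)=|\bigcup_{V\in U}V|$ (Lebesgue measure of the union). The goal is to maximize $Len(U)$ for the accepted set $U$. $\mathrm{ALG}(\mathbb{V})$ denotes the value obtained by algorithm ALG on instance $\mathbb{V}$, and $\mathrm{OPT}(\mathbb{V})$ the maximum of $Len(U)$ over all $U\subseteq\mathbb{V}$ with $|U|\le k$ (offline optimum). ALG is $\rho$-competitive if $\mathrm{OPT}(\mathbb{V})\le\rho\,\mathrm{ALG}(\mathbb{V})$ for every instance $\mathbb{V}$. In the Arbitrary-Length (AL) setting, the length $d_i-o_i$ of each released sub-interval may be any value in $[0,a]$. *)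

(* Defs.v *)
From HB Require Import structures.
From mathcomp Require Import all_boot all_order all_algebra.
From mathcomp Require Import all_classical all_reals all_analysis.

Set Implicit Arguments.
Unset Strict Implicit.
Unset Printing Implicit Defensive.

Import Order.TTheory GRing.Theory Num.Theory.
Import numFieldNormedType.Exports.

Local Open Scope classical_set_scope.
Local Open Scope ring_scope.

(* The pair [(o, d)] encodes the closed sub-interval [[o, d]].  Repetitions are
   allowed in [released], so selections below are sets of release indices. *)
Record coverage_instance (R : realType) := CoverageInstance {
  target : R;
  released : seq (R * R);
  target_gt0 : 0 < target;
  released_sub : all (fun V : R * R => [&& 0 <= V.1, V.1 <= V.2 & V.2 <= target])
                     released }.

Definition nb_released (R : realType) (I : coverage_instance R) : nat :=
  size (released I).

Definition subinterval (R : realType) (I : coverage_instance R)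
    (i : 'I_(nb_released I)) : R * R :=
  nth (0, 0) (released I) i.

Definition Len (R : realType) (I : coverage_instance R)
    (U : {set 'I_(nb_released I)}) : \bar R :=
  lebesgue_measure
    (\bigcup_(i in [set` U]) `[(subinterval i).1, (subinterval i).2]%classic).

(* [U = set0] is always admissible, so the value [-oo] is never attained. *)
Definition OPT (R : realType) (k : nat) (I : coverage_instance R) : \bar R :=
  \big[maxe/-oo%E]_(U : {set 'I_(nb_released I)} | (#|U| <= k)%N) Len U.

(* [A a past V] is the decision ([true] = accept) on the newly released [V],
   when the target interval is [[0, a]] and [past] lists the sub-intervals
   released before [V], in order.  Since the algorithm is deterministic, its own
   earlier decisions are functions of [a] and [past]. *)
Definition online_algorithm (R : realType) := R -> seq (R * R) -> R * R -> bool.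

Definition accepted (R : realType) (A : online_algorithm R)
    (I : coverage_instance R) : {set 'I_(nb_released I)} :=
  [set i : 'I_(nb_released I) |
    A (target I) (take i (released I)) (subinterval i)]%SET.

Definition ALG (R : realType) (A : online_algorithm R)
    (I : coverage_instance R) : \bar R :=
  Len (accepted A I).

Definition respects_quota (R : realType) (k : nat) (A : online_algorithm R) :=
  forall I : coverage_instance R, (#|accepted A I| <= k)%N.

(* When the number of released sub-intervals is known in advance, it is given to
   the algorithm before the first release: [B n] is the behaviour on instances
   with [n] releases, and is only ever run on these. *)
Definition online_algorithm_known (R : realType) := nat -> online_algorithm R.

Definition ALG_known (R : realType) (B : online_algorithm_known R)
    (I : coverage_instance R) : \bar R :=
  ALG (B (nb_released I)) I.

Definition respects_quota_known (R : realType) (k : nat)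
    (B : online_algorithm_known R) :=
  forall I : coverage_instance R, (#|accepted (B (nb_released I)) I| <= k)%N.

(* Main.v *)
Require Import Defs.
From HB Require Import structures.
From mathcomp Require Import all_boot all_order all_algebra.
From mathcomp Require Import all_classical all_reals all_analysis.

Import Order.TTheory GRing.Theory Num.Theory.
Import numFieldNormedType.Exports.

Local Open Scope classical_set_scope.
Local Open Scope ring_scope.

(** The adversary releases [[0, M ^ i]] for [i = 0, ..., k] with [M = 2 rho].
    By the quota some interval [j] is rejected.  On the instance that agrees
    with this one up to [j] and continues with degenerate intervals, [j] is
    still rejected, so the algorithm covers at most [M ^ j / M], whereas the
    single interval [j] covers [M ^ j]. *)

Section Coverage.
Set Implicit Arguments.
Unset Strict Implicit.
Context {R : realType}.
Implicit Types (I : coverage_instance R) (c : R).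

Lemma measurable_subinterval I (i : 'I_(nb_released I)) :
  measurable `[(subinterval i).1, (subinterval i).2]%classic.
Proof. exact: measurable_itv. Qed.

Lemma Len_le I (U : {set 'I_(nb_released I)}) c : 0 <= c ->
  (forall i, i \in U -> 0 <= (subinterval i).1 /\ (subinterval i).2 <= c) ->
  (Len U <= c%:E)%E.
Proof.
move=> c0 Uc; have -> : c%:E = lebesgue_measure `[0, c]%classic.
  by rewrite lebesgue_measure_itv /= lte_fin sube0; case: ltgtP c0 => // <-.
apply: le_measure; rewrite ?inE; [|exact: measurable_itv|].
  apply: fin_bigcup_measurable; first exact: finite_finset.
  by move=> i _; exact: measurable_subinterval.
move=> x [i /= /Uc[l0 uc]]; rewrite !in_itv /= => /andP[lx xu].
by rewrite (le_trans l0 lx) (le_trans xu uc).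
Qed.

Lemma Len1 I (i : 'I_(nb_released I)) :
  (subinterval i).1 <= (subinterval i).2 ->
  Len [set i]%SET = ((subinterval i).2 - (subinterval i).1)%:E.
Proof.
move=> le_od; rewrite /Len.
have -> : [set` [set i]%SET] = [set i].
  by apply/seteqP; split=> j /=; rewrite inE => /eqP.
rewrite bigcup_set1 lebesgue_measure_itv /= lte_fin.
by case: ltgtP le_od => // ->; rewrite subrr.
Qed.

Lemma Len_le_OPT k I (U : {set 'I_(nb_released I)}) :
  (#|U| <= k)%N -> (Len U <= OPT k I)%E.
Proof. by move=> Uk; rewrite /OPT (bigD1 U) //= le_max lexx. Qed.

Variables (k : nat) (M : R).
Hypothesis M_ge1 : 1 <= M.

(** The degenerate tail [(0, 0)] after index [j] keeps the length at [k.+1] for every [j], so an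
    algorithm told the number of releases cannot distinguish these instances in advance. *)
Definition growing_seq (j : nat) : seq (R * R) :=
  mkseq (fun i => (0, if (i <= j)%N then M ^+ i else 0)) k.+1.

Lemma growing_target_gt0 : 0 < M ^+ k.
Proof. by rewrite exprn_gt0 // (lt_le_trans ltr01). Qed.

Lemma growing_sub j :
  all (fun V : R * R => [&& 0 <= V.1, V.1 <= V.2 & V.2 <= M ^+ k])
      (growing_seq j).
Proof.
apply/allP => V /mapP[i]; rewrite mem_iota add0n ltnS => /= ik ->/=.
have M0 : 0 <= M by rewrite (le_trans ler01).
rewrite lexx /=; case: ifP => _; last by rewrite lexx exprn_ge0.
by rewrite exprn_ge0 // ler_weXn2l.
Qed.

Definition growing_instance j : coverage_instance R :=
  CoverageInstance growing_target_gt0 (growing_sub j).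

Lemma nb_released_growing j : nb_released (growing_instance j) = k.+1.
Proof. exact: size_mkseq. Qed.

Lemma subinterval_growing j (i : 'I_(nb_released (growing_instance j))) :
  subinterval i = (0, if (i <= j)%N then M ^+ i else 0).
Proof. by rewrite /subinterval nth_mkseq // -(nb_released_growing j). Qed.

(** Indistinguishability: a prefix of length at most [j] stops before the degenerate tail, so the
    decision on release [j] carries over between the two instances. *)
Lemma take_growing_seq j i : (i <= j)%N -> (j <= k)%N ->
  take i (growing_seq j) = take i (growing_seq k).
Proof.
move=> ij jk; apply: (@eq_from_nth _ (0, 0)).
  by rewrite !size_take !size_mkseq.
move=> n; rewrite size_take size_mkseq ltnS (leq_trans ij jk) => ni.
have nj := ltnW (leq_trans ni ij); have nk := leq_trans nj jk.
by rewrite !nth_take // !nth_mkseq ?ltnS // nj nk.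
Qed.

(** Pigeonhole: [k.+1] releases against a quota of [k]. The rejection is phrased through the raw
    target, past and interval rather than an index of one instance, so that it transfers to
    [growing_instance j]. *)
Lemma exists_rejected (A : online_algorithm R) :
  (#|accepted A (growing_instance k)| <= k)%N ->
  exists2 j, (j <= k)%N & ~~ A (M ^+ k) (take j (growing_seq k)) (0, M ^+ j).
Proof.
move=> cardA.
have /subsetPn[j _] : ~~ ([set: _]%SET \subset accepted A (growing_instance k)).
  apply: contraTN cardA => /subset_leq_card.
  rewrite cardsT card_ord -ltnNge; apply: leq_trans.
  by rewrite nb_released_growing.
rewrite inE subinterval_growing => rej.
have jk : (j <= k)%N by rewrite -ltnS -(nb_released_growing k).
by exists (val j) => //; move: rej; rewrite jk.
Qed.

(** Every accepted interval starts at [0], so it is enough to bound right endpoints: index [j] is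
    rejected, later ones are degenerate, and earlier ones are shorter by a factor of at least
    [M]. *)
Lemma ALG_growing_le (A : online_algorithm R) j : (j <= k)%N ->
  ~~ A (M ^+ k) (take j (growing_seq k)) (0, M ^+ j) ->
  (ALG A (growing_instance j) <= (M ^+ j / M)%:E)%E.
Proof.
move=> jk rej; have M0 : 0 < M := lt_le_trans ltr01 M_ge1.
have c0 : 0 <= M ^+ j / M by rewrite divr_ge0 ?exprn_ge0 // ltW.
apply: Len_le => // i; rewrite inE subinterval_growing /=.
case: (ltngtP i j) => [ij _|//|ij]; last first.
  by rewrite ij take_growing_seq // (negbTE rej).
by split=> //; rewrite ler_pdivlMr // -exprSr ler_weXn2l.
Qed.

Lemma OPT_growing_ge j : (0 < k)%N -> (j <= k)%N ->
  ((M ^+ j)%:E <= OPT k (growing_instance j))%E.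
Proof.
move=> k0 jk; have jn : (j < nb_released (growing_instance j))%N.
  by rewrite nb_released_growing.
have := @Len_le_OPT k _ [set Ordinal jn]%SET.
rewrite cards1 Len1 subinterval_growing /= leqnn ?subr0; first exact.
by rewrite exprn_ge0 // (le_trans ler01).
Qed.

End Coverage.

Lemma unbounded_ratio_known (R : realType) (k : nat) (hk : (0 < k)%N)
    (B : online_algorithm_known R) (rho : R) :
  respects_quota_known k B -> 1 <= rho ->
  exists I : coverage_instance R, (rho%:E * ALG_known B I < OPT k I)%E.
Proof.
move=> quotaB rho1; have rho0 : 0 < rho := lt_le_trans ltr01 rho1.
(* The factor 2 gives strictness even at [rho = 1]: [rho] times [M ^+ j / M] equals [M ^+ j / 2],
   below [M ^+ j]. *)
have M1 : 1 <= 2 * rho by rewrite (le_trans rho1) // ler_peMl ?ler1n // ltW.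
have [j jk] := exists_rejected (quotaB (growing_instance k M1 k)).
(* The rejecting algorithm becomes [B k.+1], the same one that runs on [growing_instance j]. *)
rewrite nb_released_growing => rej.
exists (growing_instance k M1 j).
apply: lt_le_trans (OPT_growing_ge M1 hk jk).
rewrite /ALG_known nb_released_growing.
have le_ALG := ALG_growing_le M1 jk rej.
apply: (le_lt_trans (lee_wpmul2l _ le_ALG)); first by rewrite lee_fin ltW.
rewrite -EFinM lte_fin invfM mulrCA [rho * _]mulrCA divff ?gt_eqF // mulr1.
by rewrite gtr_pMr ?exprn_gt0 ?mulr_gt0 // invf_lt1 // ltr1n.
Qed.

Theorem theorem1 (R : realType) (k : nat) (hk : (2 <= k)%N) :
  (forall A : online_algorithm R, respects_quota k A ->
     forall rho : R, 1 <= rho ->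
     exists I : coverage_instance R, (rho%:E * ALG A I < OPT k I)%E)
  /\
  (forall B : online_algorithm_known R, respects_quota_known k B ->
     forall rho : R, 1 <= rho ->
     exists I : coverage_instance R, (rho%:E * ALG_known B I < OPT k I)%E).
Proof.
have k0 : (0 < k)%N := ltnW hk.
split=> [A quotaA|B quotaB] rho rho1; last exact: unbounded_ratio_known.
(* An algorithm unaware of the number of releases is a constant family. *)
exact: (@unbounded_ratio_known R k k0 (fun=> A)).
Qed.
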